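(* Let $F$ be a continuous distribution function on a nonempty set $\mathcal{X} \subseteq \mathbb{R}^p$ with finite mean. For each $n \in \mathbb{N}$, let $\{\boldsymbol{\xi}_i\}_{i=1}^n \subseteq \mathcal{X}$ be support points of $F$ of size $n$ and let $F_n$ be their empirical distribution function. Let $\bm{X} \sim F$ and $\bm{X}_n \sim F_n$. Then $\bm{X}_n \xrightarrow{d} \bm{X}$ as $n \to \infty$.
   Context: For $\bm{Y}, \bm{Y}' \stackrel{i.i.d.}{\sim} F$ and a point set $\{\bm{x}_i\}_{i=1}^n \subseteq \mathcal{X}$ with empirical distribution function (e.d.f.) $F_n$, the energy distance is $E(F,F_n) = \frac{2}{n}\sum_{i=1}^n \mathbb{E}\|\bm{x}_i - \bm{Y}\|_2 - \frac{1}{n^2}\sum_{i=1}^n\sum_{j=1}^n \|\bm{x}_i - \bm{x}_j\|_2 - \mathbb{E}\|\bm{Y}-\bm{Y}'\|_2.$ For fixed $n$, support points of $F$ are a point set $\{\boldsymbol{\xi}_i\}_{i=1}^n$ that minimizes $E(F,F_n)$ over all choices of $\bm{x}_1,\dots,\bm{x}_n \in \mathcal{X}$. *)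

(* Defs.v *)
From HB Require Import structures.
From mathcomp Require Import all_boot all_order all_algebra.
From mathcomp Require Import all_classical all_reals all_analysis.
Set Implicit Arguments. Unset Strict Implicit. Unset Printing Implicit Defensive.
Import Order.TTheory GRing.Theory Num.Theory.
Import numFieldNormedType.Exports.
Local Open Scope classical_set_scope.
Local Open Scope ring_scope.

Definition Rvec (R : realType) (p : nat) : Type :=
  g_sigma_algebraType (@open 'rV[R]_p).

Definition norm2 (R : realType) (p : nat) (x : 'rV[R]_p) : R :=
  Num.sqrt (\sum_(i < p) x ord0 i ^+ 2).

Definition dist_fun (R : realType) (p : nat) (P : probability (Rvec R p) R)
  (x : 'rV[R]_p) : R :=
  fine (P [set y : Rvec R p | forall i : 'I_p, y ord0 i <= x ord0 i]).

(* Energy distance E(F, F_n) between P (law of Y, Y' iid) and the e.d.f. of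
   the point set x_1, ..., x_n. *)
Definition energy (R : realType) (p : nat) (P : probability (Rvec R p) R)
  (n : nat) (x : 'I_n -> 'rV[R]_p) : R :=
  2 / n%:R * \sum_(i < n) Rintegral P setT (fun y : Rvec R p => norm2 (x i - y))
  - (n%:R ^+ 2)^-1 * \sum_(i < n) \sum_(j < n) norm2 (x i - x j)
  - Rintegral P setT (fun y : Rvec R p =>
       Rintegral P setT (fun y' : Rvec R p => norm2 (y - y'))).

Definition support_points (R : realType) (p : nat) (P : probability (Rvec R p) R)
  (X : set 'rV[R]_p) (n : nat) (xi : 'I_n -> 'rV[R]_p) : Prop :=
  (forall i, X (xi i)) /\
  (forall x : 'I_n -> 'rV[R]_p, (forall i, X (x i)) -> energy P xi <= energy P x).

(* Main.v *)
Require Import Defs.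
From HB Require Import structures.
From mathcomp Require Import all_boot all_order all_algebra.
From mathcomp Require Import all_classical all_reals all_analysis.
From mathcomp Require Import measurable_realfun ring lra.
Set Implicit Arguments. Unset Strict Implicit. Unset Printing Implicit Defensive.
Import Order.TTheory GRing.Theory Num.Theory.
Import numFieldNormedType.Exports.
Local Open Scope classical_set_scope.
Local Open Scope ring_scope.

(* Adding points one at a time, each no worse than the average over [P], gives
   n-point sets of energy at most C / n, hence so do the support points.
   Since c |x| = \int_0^oo (1 - exp(- |x|^2 / w^2)) dw, the energy form of a
   mass-zero measure is an average over w of Gaussian forms, which are
   nonnegative by the power series of exp; so small energy forces the integrals
   of every Gaussian exp(- t |x - a|^2) to converge.  The span of these functions
   is an algebra, so its uniform closure is a lattice, and every bounded
   continuous f is an increasing limit of elements of this closure; thus the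
   integral of f is at most the lower limit of its empirical means, and the same
   holds for - f. *)

(** * The Gaussian kernel *)

(** Positivity of the Gaussian forms is proved for finitely many points, whereas the comparison
    involves [P] itself. A second greedy sample, chosen to imitate [P] both in energy and at the
    Gaussian under test, stands in for [P], so that every form that occurs is a finite double sum.
    The rate [1/n] comes from centring: a kernel of mean zero in each variable makes the cross terms
    of a new point vanish on average, and the point costs only the mean of the diagonal. Smallness
    of an integral over [w] says nothing about a single [w]. The form is therefore kept large on a
    whole interval [[w, w + h]] by a bound on its variation, with [h] fixed before [n] tends to
    infinity. On a noncompact space a bounded continuous [f] is in general not a uniform limit of
    Gaussian combinations, and mass of the empirical measures might a priori escape to infinity.
    Approximation from below meets both obstacles: it may be poor far away and still yields a lower
    bound for the means of [f]. *)

Definition dotv {R : realType} {p : nat} (x y : 'rV[R]_p) : R :=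
  \sum_(i < p) x ord0 i * y ord0 i.

Section Euclid.
Context {R : realType} {p : nat}.
Implicit Types x y z a b : 'rV[R]_p.

Lemma dotvv_ge0 x : 0 <= dotv x x.
Proof. by apply: sumr_ge0 => i _; rewrite -expr2 sqr_ge0. Qed.

Lemma norm2_dotv x : norm2 x = Num.sqrt (dotv x x).
Proof. by []. Qed.

Lemma sqr_norm2 x : norm2 x ^+ 2 = dotv x x.
Proof. by rewrite norm2_dotv sqr_sqrtr // dotvv_ge0. Qed.

Lemma norm2_ge0 x : 0 <= norm2 x.
Proof. exact: sqrtr_ge0. Qed.

Lemma dotvB x y : dotv (x - y) (x - y) = dotv x x + dotv y y - 2 * dotv x y.
Proof.
rewrite /dotv mulr_sumr -big_split /= -sumrB.
by apply: eq_bigr => i _; rewrite !mxE; ring.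
Qed.

Lemma dotv_cauchy_schwarz x y : dotv x y ^+ 2 <= dotv x x * dotv y y.
Proof.
(* Lagrange's identity: this sum of squares is twice the difference of the two sides. *)
have : 0 <= \sum_(i < p) \sum_(j < p)
    (x ord0 i * y ord0 j - x ord0 j * y ord0 i) ^+ 2.
  by do 2!apply: sumr_ge0 => ? _; exact: sqr_ge0.
have -> : \sum_(i < p) \sum_(j < p)
    (x ord0 i * y ord0 j - x ord0 j * y ord0 i) ^+ 2 =
    dotv x x * dotv y y + dotv y y * dotv x x - 2 * (dotv x y * dotv x y).
  rewrite /dotv !big_distrlr mulr_sumr /= -big_split -sumrB /=.
  apply: eq_bigr => i _; rewrite mulr_sumr -big_split -sumrB /=.
  by apply: eq_bigr => j _; ring.
by rewrite expr2; nra.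
Qed.

Lemma norm2N x : norm2 (- x) = norm2 x.
Proof. by congr Num.sqrt; apply: eq_bigr => i _; rewrite mxE sqrrN. Qed.

Lemma norm2_distC x y : norm2 (x - y) = norm2 (y - x).
Proof. by rewrite -norm2N opprB. Qed.

Lemma norm2_triangle x y : norm2 (x + y) <= norm2 x + norm2 y.
Proof.
rewrite -(@ler_pXn2r _ 2) ?nnegrE ?addr_ge0 ?norm2_ge0 //.
have := dotvB x (- y); rewrite opprK sqr_norm2 => ->.
have -> : dotv x (- y) = - dotv x y.
  by rewrite -sumrN; apply: eq_bigr => i _; rewrite mxE mulrN.
rewrite -!sqr_norm2 norm2N.
suff : dotv x y <= norm2 x * norm2 y by nra.
rewrite (le_trans (ler_norm _)) // -(@ler_pXn2r _ 2) ?nnegrE ?mulr_ge0 ?norm2_ge0 //.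
by rewrite exprMn !sqr_norm2 real_normK ?num_real // dotv_cauchy_schwarz.
Qed.

Lemma ler_dist_norm2 x y z : `|norm2 (x - z) - norm2 (y - z)| <= norm2 (x - y).
Proof.
rewrite ler_distl; apply/andP; split.
  have := norm2_triangle (y - x) (x - z).
  by rewrite addrA subrK (norm2_distC y x); lra.
have := norm2_triangle (x - y) (y - z).
by rewrite addrA subrK; lra.
Qed.

Lemma coord_le_norm2 x i : `|x ord0 i| <= norm2 x.
Proof.
rewrite -(@ler_pXn2r _ 2) ?nnegrE ?norm2_ge0 // real_normK ?num_real //.
rewrite sqr_norm2 /dotv (bigD1 i) //= -expr2 lerDl.
by apply: sumr_ge0 => j _; rewrite -expr2 sqr_ge0.
Qed.

Lemma cvg_bigsum (T I : Type) (F : set_system T) (r : seq I) (f : I -> T -> R)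
    (l : I -> R) {FF : Filter F} : (forall i, f i u @[u --> F] --> l i) ->
  \sum_(i <- r) f i u @[u --> F] --> \sum_(i <- r) l i.
Proof. by move=> fl; apply: cvg_big => // -[? ?]; exact: add_continuous. Qed.

Lemma continuous_dotvB a : continuous (fun x => dotv (x - a) (x - a)).
Proof.
move=> x; apply: (@cvg_bigsum _ _ (nbhs x)) => i.
have c : {for x, continuous (fun x : 'rV[R]_p => (x - a) ord0 i)}.
  rewrite (_ : (fun x : 'rV_p => (x - a) ord0 i) =
    (fun x : 'rV_p => x ord0 i) - cst (a ord0 i)).
    apply: continuousB; last exact: cst_continuous.
    exact: (@coord_continuous R 1 p ord0 i x).
  by apply/funext => y; rewrite fctE !mxE.
exact: continuousM.
Qed.

Lemma continuous_norm2B a : continuous (fun x => norm2 (x - a)).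
Proof.
move=> x; apply: (@continuous_comp _ _ _ (fun x => dotv (x - a) (x - a)) Num.sqrt).
  exact: continuous_dotvB.
exact: sqrt_continuous.
Qed.

Definition gauss (t : R) (a x : 'rV[R]_p) : R := expR (- (t * dotv (x - a) (x - a))).

Lemma gauss_gt0 t a x : 0 < gauss t a x.
Proof. exact: expR_gt0. Qed.

Lemma gauss_le1 t a x : 0 <= t -> gauss t a x <= 1.
Proof. by move=> t0; rewrite expR_le1 oppr_le0 mulr_ge0 // dotvv_ge0. Qed.

Lemma gaussC t a x : gauss t a x = gauss t x a.
Proof. by rewrite /gauss -!sqr_norm2 norm2_distC. Qed.

Lemma gaussxx t a : gauss t a a = 1.
Proof.
rewrite /gauss subrr /dotv big1 ?mulr0 ?oppr0 ?expR0 //.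
by move=> i _; rewrite mxE mul0r.
Qed.

Lemma continuous_gauss t a : continuous (gauss t a).
Proof.
move=> x; apply: (@continuous_comp _ _ _ (fun x => - (t * dotv (x - a) (x - a))) expR).
  apply: continuousN; apply: continuousM; first exact: cst_continuous.
  exact: continuous_dotvB.
exact: continuous_expR.
Qed.

(** One factor [dotv (x i) (x j)] splits into coordinates, and each coordinate is absorbed into the
    coefficients; hence the induction has to range over all [c]. *)
Lemma psd_dotvX (I : finType) (c : I -> R) (x : I -> 'rV[R]_p) (k : nat) :
  0 <= \sum_i \sum_j c i * c j * dotv (x i) (x j) ^+ k.
Proof.
elim: k c => [|k IH] c.
  have -> : \sum_i \sum_j c i * c j * dotv (x i) (x j) ^+ 0 = (\sum_i c i) ^+ 2.
    rewrite expr2 big_distrlr; apply: eq_bigr => i _; apply: eq_bigr => j _.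
    by rewrite expr0 mulr1.
  exact: sqr_ge0.
have -> : \sum_i \sum_j c i * c j * dotv (x i) (x j) ^+ k.+1 =
    \sum_(l < p) \sum_i \sum_j
      (c i * x i ord0 l) * (c j * x j ord0 l) * dotv (x i) (x j) ^+ k.
  rewrite [RHS]exchange_big; apply: eq_bigr => i _ /=.
  rewrite [RHS]exchange_big; apply: eq_bigr => j _ /=.
  rewrite exprS {1}/dotv mulr_suml mulr_sumr.
  by apply: eq_bigr => l _; ring.
by apply: sumr_ge0 => l _; exact: IH.
Qed.

Lemma psd_exp_dotv (I : finType) (c : I -> R) (x : I -> 'rV[R]_p) (t : R) :
  0 <= t -> 0 <= \sum_i \sum_j c i * c j * expR (t * dotv (x i) (x j)).
Proof.
move=> t0.
have cv : (fun N : nat => \sum_i \sum_j c i * c j *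
      series (exp_coeff (t * dotv (x i) (x j))) N) @ \oo -->
    \sum_i \sum_j c i * c j * expR (t * dotv (x i) (x j)).
  apply: cvg_bigsum => i; apply: cvg_bigsum => j; apply: cvgM; first exact: cvg_cst.
  exact: is_cvg_series_exp_coeff.
rewrite -(cvg_lim _ cv) //; apply: limr_ge; first by apply/cvg_ex; eexists; exact: cv.
near=> N.
have -> : \sum_i \sum_j c i * c j * series (exp_coeff (t * dotv (x i) (x j))) N =
   \sum_(0 <= k < N) (t ^+ k / k`!%:R) *
     (\sum_i \sum_j c i * c j * dotv (x i) (x j) ^+ k).
  under [RHS]eq_bigr do rewrite mulr_sumr.
  rewrite [RHS]exchange_big; apply: eq_bigr => i _ /=.
  under [RHS]eq_bigr do rewrite mulr_sumr.
  rewrite [RHS]exchange_big; apply: eq_bigr => j _ /=.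
  rewrite /series /= mulr_sumr; apply: eq_bigr => k _.
  by rewrite exp_coeffE exprMn; ring.
by apply: sumr_ge0 => k _; rewrite mulr_ge0 ?divr_ge0 ?exprn_ge0 ?psd_dotvX.
Unshelve. all: end_near. Qed.

Lemma psd_gauss (I : finType) (c : I -> R) (x : I -> 'rV[R]_p) (t : R) :
  0 <= t -> 0 <= \sum_i \sum_j c i * c j * gauss t (x i) (x j).
Proof.
move=> t0.
(* Expanding the square, [gauss] is [expR (2 * t * dotv x y)] times one factor in [x] and one in
   [y]; these factors rescale the coefficients. *)
have := @psd_exp_dotv I (fun i => c i * expR (- (t * dotv (x i) (x i)))) x (2 * t).
move/(_ (mulr_ge0 (ler0n R 2) t0)); congr (0 <= _).
apply: eq_bigr => i _; apply: eq_bigr => j _.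
rewrite gaussC /gauss dotvB.
have -> : - (t * (dotv (x i) (x i) + dotv (x j) (x j) - 2 * dotv (x i) (x j))) =
    - (t * dotv (x i) (x i)) + - (t * dotv (x j) (x j)) + 2 * t * dotv (x i) (x j).
  by ring.
by rewrite !expRD; ring.
Qed.

(** Cauchy-Schwarz for the Gaussian form: adjoining the point [a] with the optimal weight [- L]
    turns the form [Q] into [Q - L ^+ 2], which is still nonnegative. *)
Lemma gauss_sum_sqr_le (I : finType) (c : I -> R) (x : I -> 'rV[R]_p) (t : R) a :
  0 <= t -> (\sum_i c i * gauss t a (x i)) ^+ 2 <=
    \sum_i \sum_j c i * c j * gauss t (x i) (x j).
Proof.
move=> t0; set L := \sum_i c i * gauss t a (x i).
have := @psd_gauss (option I)
  (fun s => if s is Some i then c i else - L)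
  (fun s => if s is Some i then x i else a) t t0.
have big_opt (F : option I -> R) : \sum_s F s = F None + \sum_i F (Some i).
  rewrite (bigD1 None) //=; congr (_ + _).
  rewrite (reindex_omap Some id) /=; last by case.
  by apply: eq_bigl => i; rewrite eqxx.
rewrite big_opt big_opt gaussxx.
have -> : \sum_i - L * c i * gauss t a (x i) = - L * L.
  by rewrite mulr_sumr; apply: eq_bigr => i _; ring.
under [X in _ <= _ + X -> _]eq_bigr do rewrite big_opt.
rewrite big_split /=.
have -> : \sum_i c i * - L * gauss t (x i) a = - L * L.
  by rewrite mulr_sumr; apply: eq_bigr => i _; rewrite gaussC; ring.
by rewrite expr2; lra.
Qed.
End Euclid.

(** * Gaussian forms and the energy form *)

Section Subordination.
Context {R : realType}.
Notation mu := (@lebesgue_measure R).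
Notation pos_line := (`]0%R, +oo[%classic : set R).

Lemma ge0_integral_scale (k : R) (f : R -> \bar R) : 0 < k ->
  measurable_fun pos_line f -> (forall x, 0 <= f x)%E ->
  (\int[mu]_(x in pos_line) f x = k%:E * \int[mu]_(x in pos_line) f (k * x)%R)%E.
Proof.
move=> k0 mf f0.
pose phi (x : measurableTypeR R) : measurableTypeR R := k * (x : R).
have mphi : measurable_fun setT phi by exact: mulrl_measurable.
pose k' : {nonneg R} := NngNum (ltW k0).
pose nu : {measure set (measurableTypeR R) -> \bar R} :=
  measure_function_pushforward__canonical__measure_function_Measure mu mphi.
(* Lebesgue measure is [k] times its image under multiplication by [k], as both agree on half-open
   intervals. *)
transitivity (\int[mscale k' nu]_(x in pos_line) f x)%E.
  apply: eq_measure_integral => A mA _.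
  apply: lebesgue_measure_unique => // _ [[a b] _ <-].
  rewrite -[RHS]/(k%:E * mu (phi @^-1` `]a, b]%classic))%E.
  have -> : phi @^-1` `]a, b] = `]a / k, b / k]%classic.
    apply/seteqP; split => x; rewrite /phi /= !in_itv /= => /andP[ax xb].
      by rewrite ltr_pdivrMr // ler_pdivlMr // (mulrC x) ax xb.
    by rewrite (mulrC k) -ltr_pdivrMr // ax -ler_pdivlMr // xb.
  rewrite !lebesgue_measure_itv /= !lte_fin ltr_pM2r ?invr_gt0 //.
  case: ifPn => _; last by rewrite mule0.
  by rewrite -EFinB -EFinM; congr EFin; field; rewrite gt_eqF.
rewrite ge0_integral_mscale //=.
congr (_ * _)%E; rewrite ge0_integral_pushforward //.
apply: (congr1 (fun D => \int[mu]_(x in D) f (k * (x : R))%R)%E).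
by apply/seteqP; split => x /=; rewrite !in_itv /= !andbT pmulr_rgt0.
Qed.

(** Here [s] is a squared distance and [w] the width of the Gaussian. With the width as variable the
    weight is Lebesgue measure itself, and rescaling [w] produces the factor [Num.sqrt s]. *)
Definition bump (s w : R) : R := 1 - expR (- (w ^- 2 * s)).

Lemma bump_ge0 s w : 0 <= s -> 0 <= bump s w.
Proof.
by move=> s0; rewrite subr_ge0 expR_le1 oppr_le0 mulr_ge0 // invr_ge0 sqr_ge0.
Qed.

Lemma measurable_bump s : measurable_fun pos_line (bump s).
Proof.
apply: open_continuous_measurable_fun => // w; rewrite inE /= in_itv /= andbT => w0.
rewrite (_ : bump s = cst 1 - (fun w : R => expR (- (w ^- 2 * s)))) //.
apply: continuousB; first exact: cst_continuous.
apply: (@continuous_comp _ _ _ (fun w : R => - (w ^- 2 * s)) expR); last exact: continuous_expR.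
apply: continuousN; apply: continuousM; last exact: cst_continuous.
apply: continuousV; first by rewrite expf_neq0 // gt_eqF.
exact: exprn_continuous.
Qed.

Lemma integral_bump1_lty : (\int[mu]_(w in pos_line) (bump 1 w)%:E < +oo)%E.
Proof.
(* With [v = w ^- 2], [1 - expR (- v)] is at most [1] and at most [v], so its product with
   [1 + w ^+ 2] is at most [1 + v * w ^+ 2 = 2]. *)
apply: (@le_lt_trans _ _ (\int[mu]_(w in pos_line) (2%:E * (oneDsqr w)^-1%:E))%E).
  apply: ge0_le_integral => //=.
  - by move=> w _; rewrite lee_fin bump_ge0.
  - by apply/measurable_EFinP; exact: measurable_bump.
  - apply: measurable_funeM; apply/measurable_EFinP; apply: measurable_funTS.
    by apply: continuous_measurable_fun; exact: continuous_oneDsqrV.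
  move=> w; rewrite /= in_itv /= andbT => w0.
  have o0 : 0 < oneDsqr w by rewrite (lt_le_trans _ (oneDsqr_ge1 w)).
  rewrite -EFinM lee_fin ler_pdivlMr // /bump /oneDsqr mulr1.
  have w20 : 0 < w ^+ 2 by rewrite exprn_gt0.
  have := expR_ge1Dx (- w ^- 2); have := expR_gt0 (- w ^- 2).
  have : w ^- 2 * w ^+ 2 = 1 by rewrite mulVf // gt_eqF.
  set e := expR _; set v := w ^- 2; nra.
have mo : measurable_fun pos_line (fun w => (oneDsqr w)^-1%:E).
  apply/measurable_EFinP; apply: measurable_funTS.
  by apply: continuous_measurable_fun; exact: continuous_oneDsqrV.
rewrite ge0_integralZl //=.
rewrite integral_itv_obnd_cbnd //.
by rewrite integral0y_oneDsqr -EFinM ltry.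
Qed.

Definition subc : R := Rintegral mu pos_line (bump 1).

Lemma integral_bump s : 0 <= s ->
  (\int[mu]_(w in pos_line) (bump s w)%:E = (Num.sqrt s * subc)%:E)%E.
Proof.
rewrite le_eqVlt => /predU1P[<-|s0].
  rewrite sqrtr0 mul0r; apply: integral0_eq => w _.
  by rewrite /bump mulr0 oppr0 expR0 subrr.
have r0 : 0 < Num.sqrt s by rewrite sqrtr_gt0.
have := @ge0_integral_scale (Num.sqrt s) (fun w => (bump s w)%:E) r0.
move=> ->; last 2 first.
- by apply/measurable_EFinP; exact: measurable_bump.
- by move=> w; rewrite lee_fin bump_ge0 // ltW.
rewrite EFinM; congr (_ * _)%E.
rewrite /subc /Rintegral fineK; last first.
  rewrite ge0_fin_numE ?integral_bump1_lty //.
  by apply: integral_ge0 => w _; rewrite lee_fin bump_ge0.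
apply: eq_integral => w; rewrite inE /= in_itv /= andbT => w0.
congr (_%:E); rewrite /bump exprMn sqr_sqrtr ?ltW //; congr (1 - expR (- _)).
by field; rewrite !gt_eqF.
Qed.

Lemma integrable_bump s : 0 <= s ->
  mu.-integrable pos_line (EFin \o bump s).
Proof.
move=> s0; apply/integrableP; split; first by apply/measurable_EFinP; exact: measurable_bump.
rewrite (_ : (\int[mu]_(w in _) _ = (Num.sqrt s * subc)%:E)%E) ?ltry //.
rewrite -integral_bump //; apply: eq_integral => w _.
by rewrite /= ger0_norm // bump_ge0.
Qed.

Lemma integrableRZ d (T : measurableType d) (m : {measure set T -> \bar R})
    (D : set T) (f : T -> R) (k : R) : measurable D ->
  m.-integrable D (EFin \o f) -> m.-integrable D (EFin \o (fun x => k * f x)).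
Proof. by move=> mD /(integrableZl mD k). Qed.

(** Integrability is returned along with the value so that the lemma can be iterated on double
    sums. *)
Lemma Rintegral_bigsum d (T : measurableType d) (m : {measure set T -> \bar R})
    (D : set T) (I : Type) (r : seq I) (F : I -> T -> R) : measurable D ->
  (forall i, m.-integrable D (EFin \o F i)) ->
  m.-integrable D (EFin \o (fun x => \sum_(i <- r) F i x)) /\
  Rintegral m D (fun x => \sum_(i <- r) F i x) = \sum_(i <- r) Rintegral m D (F i).
Proof.
move=> mD iF; elim: r => [|i r [IH1 IH2]].
  rewrite big_nil; under eq_fun do rewrite big_nil.
  by split; [exact: integrable0|rewrite Rintegral_cst // mul0r].
rewrite big_cons; under eq_fun do rewrite big_cons; split.
  exact: (integrableD mD (iF i) IH1).
by rewrite RintegralD // IH2.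
Qed.

(** The bound is uniform in [s] because [y * expR (- y) <= 1] at [y = u ^- 2 * s]; what remains is
    [(u / w) ^+ 2 - 1 <= (1 + h / w) ^+ 2 - 1], at most [3 * h / w] as [h <= w]. *)
Lemma expRN_sub_le (s w u h : R) : 0 <= s -> 0 < w -> w <= u <= w + h -> h <= w ->
  `|expR (- (u ^- 2 * s)) - expR (- (w ^- 2 * s))| <= 3 * h / w.
Proof.
move=> s0 w0 /andP[wu uh] hw.
have u0 : 0 < u by exact: lt_le_trans wu.
have vu : u ^- 2 <= w ^- 2.
  by rewrite lef_pV2 ?posrE ?exprn_gt0 // ler_pXn2r // nnegrE ltW.
have le : expR (- (w ^- 2 * s)) <= expR (- (u ^- 2 * s)).
  by rewrite ler_expR lerN2 ler_wpM2r.
rewrite ger0_norm ?subr_ge0 //.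
have -> : - (w ^- 2 * s) = - (u ^- 2 * s) + - ((w ^- 2 - u ^- 2) * s) by ring.
rewrite expRD; set E := expR (- (u ^- 2 * s)).
have E0 : 0 < E by exact: expR_gt0.
have h1 := expR_ge1Dx (- ((w ^- 2 - u ^- 2) * s)).
have h2 : E * (u ^- 2 * s) <= 1.
  rewrite /E expRN mulrC ler_pdivrMr ?expR_gt0 // mul1r.
  by have := expR_ge1Dx (u ^- 2 * s); lra.
apply: (@le_trans _ _ (E * (u ^- 2 * s) * ((u / w) ^+ 2 - 1))).
  have -> : E * (u ^- 2 * s) * ((u / w) ^+ 2 - 1) = E * ((w ^- 2 - u ^- 2) * s).
    by field; rewrite !gt_eqF.
  have -> : E - E * expR (- ((w ^- 2 - u ^- 2) * s)) = E * (1 - expR (- ((w ^- 2 - u ^- 2) * s))) by ring.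
  by rewrite ler_pM2l //; lra.
have q1 : 1 <= u / w by rewrite ler_pdivlMr // mul1r.
have q2 : u / w <= 1 + h / w by rewrite ler_pdivrMr // mulrDl divfK ?gt_eqF // mul1r.
have hw1 : h / w <= 1 by rewrite ler_pdivrMr // mul1r.
have hw0 : 0 <= h / w by lra.
apply: (@le_trans _ _ ((u / w) ^+ 2 - 1)).
  by rewrite ler_piMl //; nra.
rewrite -mulrA; nra.
Qed.

(* The formula [|x| * subc = \int_0^oo (1 - exp(- |x|^2 / w^2)) dw] writes the
   energy form of a mass-zero signed measure as an integral over [w] of the
   nonnegative Gaussian forms; the latter vary slowly in [w]. *)
Lemma gauss_form_le_energy (p : nat) (I : finType) (c : I -> R)
    (x : I -> 'rV[R]_p) (w h : R) : \sum_i c i = 0 -> 0 < w -> 0 < h <= w ->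
  h * (\sum_i \sum_j c i * c j * gauss (w ^- 2) (x i) (x j)
       - (\sum_i `|c i|) ^+ 2 * (3 * h / w)) <=
  subc * - \sum_i \sum_j c i * c j * norm2 (x i - x j).
Proof.
move=> c0 w0 /andP[h0 hw].
pose m u := \sum_i \sum_j c i * c j * gauss (u ^- 2) (x i) (x j).
pose s i j := dotv (x i - x j) (x i - x j).
have s0 i j : 0 <= s i j by exact: dotvv_ge0.
have gE u i j : gauss (u ^- 2) (x i) (x j) = 1 - bump (s i j) u.
  by rewrite gaussC /gauss /bump /s; ring.
have mE u : m u = \sum_i \sum_j (- (c i * c j)) * bump (s i j) u.
  (* The constant [1] in [gE] contributes [(\sum_i c i) ^+ 2 = 0]. *)
  rewrite -[RHS]add0r -[X in X + _](mul0r (\sum_i c i)) -{1}c0 big_distrlr -big_split /=.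
  apply: eq_bigr => i _; rewrite -big_split; apply: eq_bigr => j _ /=.
  by rewrite gE; ring.
have ibump i j : mu.-integrable pos_line (EFin \o (fun u => (- (c i * c j)) * bump (s i j) u)).
  exact/integrableRZ/integrable_bump.
have mL : measurable (pos_line : set (measurableTypeR R)) by exact: measurable_itv.
have inner i := Rintegral_bigsum (index_enum I) mL (ibump i).
have [im Im] := Rintegral_bigsum (index_enum I) mL
  (fun i => (inner i).1).
have {Im} <- : Rintegral mu pos_line m = subc * - \sum_i \sum_j c i * c j * norm2 (x i - x j).
  rewrite (_ : m = fun u => \sum_i \sum_j (- (c i * c j)) * bump (s i j) u); last exact/funext.
  rewrite Im -sumrN mulr_sumr; apply: eq_bigr => i _.
  rewrite (inner i).2 -sumrN mulr_sumr; apply: eq_bigr => j _.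
  rewrite RintegralZl //; last exact: integrable_bump.
  by rewrite /Rintegral integral_bump //= /norm2 /s /dotv; ring.
have {}im : mu.-integrable pos_line (EFin \o m).
  by rewrite (_ : m = fun u => \sum_i \sum_j (- (c i * c j)) * bump (s i j) u)//; exact/funext.
set C := m w - _; rewrite -/(m w) -/C.
have m0 u : 0 <= m u by apply: psd_gauss; rewrite invr_ge0 sqr_ge0.
have mC u : w <= u <= w + h -> C <= m u.
  move=> wu; rewrite /C lerBlDl -lerBlDr.
  apply: le_trans (ler_norm _) _.
  rewrite distrC /m -sumrB [(\sum_i _) ^+ 2]expr2 big_distrlr mulr_suml /=.
  apply: le_trans (ler_norm_sum _ _ _) _; apply: ler_sum => i _.
  rewrite -sumrB mulr_suml.
  apply: le_trans (ler_norm_sum _ _ _) _; apply: ler_sum => j _.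
  rewrite -mulrBr !normrM ler_wpM2l // gaussC (gaussC (w ^- 2)).
  by apply: expRN_sub_le => //; exact: dotvv_ge0.
have mI : measurable (`[w, w + h]%classic : set R) by exact: measurable_itv.
have indE : (\int[mu]_(u in pos_line) (\1_(`[w, w + h]) u)%:E = h%:E)%E.
  rewrite integral_indic // (_ : _ `&` _ = `[w, w + h]%classic).
    apply: etrans (lebesgue_measure_itv `[w, w + h]) _.
    by rewrite /= lte_fin ltrDl h0 -EFinB addrAC subrr add0r.
  apply/seteqP; split => u /=; first by case.
  by move=> wu; split => //; move: wu; rewrite !in_itv /= andbT => /andP[]; lra.
have iI : mu.-integrable pos_line (EFin \o (\1_(`[w, w + h]) : R -> R)).
  apply: (@integrableS _ _ _ _ setT) => //.
  apply: integrable_indic_itv.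
(* [m] is at least [C] on [[w, w + h]] and nonnegative elsewhere, hence it dominates [C] times the
   indicator. *)
have -> : h * C = Rintegral mu pos_line (fun u => C * \1_(`[w, w + h]) u).
  by rewrite RintegralZl // /Rintegral indE mulrC.
apply: le_Rintegral => //.
  exact: integrableRZ.
move=> u _; rewrite indicE; have [|_] := boolP (u \in _); last by rewrite mulr0 m0.
by rewrite inE /= in_itv /= mulr1 => /mC.
Qed.

End Subordination.

(** * Greedy choice of points *)

Section Mean.
Context d {T : measurableType d} {R : realType} (P : probability T R).
Local Notation L1 f := (P.-integrable setT (EFin \o f)).
Local Notation E f := (Rintegral P setT f).
Implicit Types f g : T -> R.

Lemma L1_cst (k : R) : L1 (fun=> k).
Proof. exact: finite_measure_integrable_cst. Qed.

Lemma mean_cst (k : R) : E (fun=> k) = k.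
Proof. by rewrite Rintegral_cst //= probability_setT mulr1. Qed.

Lemma L1_D f g : L1 f -> L1 g -> L1 (fun x => f x + g x).
Proof. by move=> if1 ig; exact: (integrableD measurableT if1 ig). Qed.

Lemma L1_B f g : L1 f -> L1 g -> L1 (fun x => f x - g x).
Proof. by move=> if1 ig; exact: (integrableB measurableT if1 ig). Qed.

Lemma L1_Z (k : R) f : L1 f -> L1 (fun x => k * f x).
Proof. exact: integrableRZ. Qed.

(** Otherwise [f - E f] would be positive on a set of full measure with integral zero. The point is
    sought in [A] because support points compete only with points of [X]. *)
Lemma exists_le_mean (A : set T) f : measurable A -> P A = 1%E -> L1 f ->
  exists2 x, A x & f x <= E f.
Proof.
move=> mA PA if1; apply: contrapT => nex.
have gt0 x : A x -> 0 < f x - E f.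
  move=> Ax; rewrite subr_gt0 ltNge; apply/negP => fx; apply: nex.
  by exists x.
have ig : L1 (fun x => f x - E f) by apply: L1_B => //; exact: L1_cst.
have PCA : P (~` A) = 0%E by rewrite probability_setC // PA subee.
have int0 : (\int[P]_(x in A) `|(f x - E f)%:E| = 0)%E.
  have -> : A = setT `\` ~` A by rewrite setTD setCK.
  rewrite (eq_integral (EFin \o (fun x => f x - E f))).
    rewrite -negligible_integral //; last exact: measurableC.
    rewrite -[LHS]fineK ?integrable_fin_num //.
    by rewrite -[fine _]/(E (fun x => f x - E f)) RintegralB ?mean_cst ?subrr //; exact: L1_cst.
  by move=> x; rewrite setTD setCK inE => /gt0 x0; rewrite /= gtr0_norm.
have mfA : measurable_fun A (EFin \o (fun x => f x - E f)).
  exact: measurable_funTS (measurable_int _ ig).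
have [N [mN PN subN]] := (ae_eq_integral_abs P mA mfA).1 int0.
have AN : A `<=` N.
  move=> x Ax; apply: subN => /(_ Ax) /= [] fx.
  by have := gt0 x Ax; rewrite fx ltxx.
have : (P A <= P N)%E by rewrite le_measure ?inE.
by rewrite PA PN lee_fin ler10.
Qed.

(** Adding [x] changes the left side by [incr x], whose mean is that of the diagonal of [K], since
    [f] and all [K (z l)] have mean zero. The linear term [f] allows the sample to be coupled to
    given points. *)
Lemma greedy_sum_le_mean (A : set T) f (K : T -> T -> R) : measurable A -> P A = 1%E ->
    L1 f -> E f = 0 -> (forall x y, K x y = K y x) ->
    (forall x, L1 (K x)) -> (forall x, E (K x) = 0) -> L1 (fun x => K x x) ->
  forall m : nat, exists2 z : nat -> T, (forall j, (j < m)%N -> A (z j)) &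
    \sum_(j < m) f (z j) + \sum_(j < m) \sum_(l < m) K (z j) (z l)
      <= m%:R * E (fun x => K x x).
Proof.
move=> mA PA if1 f0 Ksym iK K0 iKK; elim=> [|m [z Az IH]].
  have [x _ _] := exists_le_mean mA PA if1.
  by exists (fun=> x) => //; rewrite !big_ord0 addr0 mul0r.
have [isum Esum] := Rintegral_bigsum (index_enum 'I_m) measurableT (fun l : 'I_m => iK (z l)).
pose incr x := f x + 2 * (\sum_(l < m) K (z l) x) + K x x.
have iincr0 : L1 (fun x => f x + 2 * (\sum_(l < m) K (z l) x)).
  by apply: L1_D => //; exact: L1_Z.
have iincr : L1 incr by exact: L1_D.
have Eincr : E incr = E (fun x => K x x).
  rewrite RintegralD // RintegralD //; last exact: L1_Z.
  by rewrite RintegralZl // Esum f0 big1 ?mulr0 ?add0r.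
have [x Ax xle] := exists_le_mean mA PA iincr.
(* Only the value at [m] matters; later indices also receive [x]. *)
pose z' j := if (j < m)%N then z j else x.
have zE (j : 'I_m) : z' j = z j by rewrite /z' ltn_ord.
have zm : z' m = x by rewrite /z' ltnn.
exists z' => [j|]; first by rewrite /z'; case: ifPn => // /Az.
have -> : \sum_(j < m.+1) f (z' j) = \sum_(j < m) f (z j) + f x.
  by rewrite big_ord_recr /= zm; congr (_ + _); apply: eq_bigr => j _; rewrite zE.
have -> : \sum_(j < m.+1) \sum_(l < m.+1) K (z' j) (z' l) =
    \sum_(j < m) \sum_(l < m) K (z j) (z l) + 2 * \sum_(l < m) K (z l) x + K x x.
  have row j : \sum_(l < m.+1) K (z' j) (z' l) =
      \sum_(l < m) K (z' j) (z l) + K (z' j) x.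
    by rewrite big_ord_recr /= zm; congr (_ + _); apply: eq_bigr => l _; rewrite zE.
  rewrite big_ord_recr /= row zm; under eq_bigr do rewrite row zE.
  rewrite big_split /= addrA; congr (_ + _); rewrite -addrA; congr (_ + _).
  have -> : \sum_(l < m) K x (z l) = \sum_(l < m) K (z l) x.
    by apply: eq_bigr => l _; exact: Ksym.
  by ring.
move: xle; rewrite Eincr /incr -[m.+1]addn1 natrD mulrDl mul1r; move: IH.
set d1 := E _; lra.
Qed.

End Mean.

(** * The energy distance as a quadratic form of a centred kernel *)

Section EnergyKernel.
Context {R : realType} {p : nat} (P : probability (Rvec R p) R).
Local Notation L1 f := (P.-integrable setT (EFin \o (f : Rvec R p -> R))).
Local Notation E f := (Rintegral P setT (f : Rvec R p -> R)).
Implicit Types f g : 'rV[R]_p -> R.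

Lemma continuous_atP f x : {for x, continuous f} <->
  (forall e : R, 0 < e -> nbhs x [set y | `|f x - f y| < e]).
Proof. exact: (@cvgrPdist_lt _ _ _ _ (nbhs_filter x)). Qed.

Lemma continuous_measurable_Rvec f : continuous f ->
  measurable_fun setT (f : Rvec R p -> R).
Proof.
move=> /continuousP cf; apply: (measurability _ (RGenOpens.measurableE R)).
move=> _ [_ [a [b ->] <-]]; rewrite setTI; apply: sub_sigma_algebra.
exact/cf/interval_open.
Qed.

Lemma L1_bounded f (M : R) : continuous f -> (forall x, `|f x| <= M) -> L1 f.
Proof.
move=> cf fM; apply: (le_integrable measurableT _ _ (L1_cst P M)).
  by apply/measurable_EFinP; exact: continuous_measurable_Rvec.
by move=> x _; rewrite /= lee_fin (le_trans (fM x)) // ler_norm.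
Qed.

Context (L1_norm2 : L1 (@norm2 R p)).

Lemma L1_norm2B (x : 'rV[R]_p) : L1 (fun y => norm2 (x - y)).
Proof.
apply: (le_integrable measurableT _ _ (L1_D (L1_cst P (norm2 x)) L1_norm2)).
  apply/measurable_EFinP; apply: continuous_measurable_Rvec.
  by rewrite (funext (norm2_distC x)); exact: continuous_norm2B.
move=> y _; rewrite /= lee_fin !ger0_norm ?addr_ge0 ?norm2_ge0 //.
by rewrite -(norm2N y) norm2_triangle.
Qed.

Definition mean_dist (x : 'rV[R]_p) : R := E (fun y => norm2 (x - y)).

(** This yields continuity, hence measurability, of [mean_dist], as well as its linear growth, hence
    integrability. *)
Lemma mean_dist_lip (x y : 'rV[R]_p) : `|mean_dist x - mean_dist y| <= norm2 (x - y).
Proof.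
rewrite /mean_dist -RintegralB //; try exact: L1_norm2B.
apply: le_trans (le_normr_Rintegral _ _) _ => //.
  by apply: L1_B; exact: L1_norm2B.
rewrite -[leRHS](mean_cst P); apply: le_Rintegral => //.
- by apply: integrable_norm; apply: L1_B; exact: L1_norm2B.
- exact: L1_cst.
- by move=> z _; exact: ler_dist_norm2.
Qed.

Lemma L1_mean_dist : L1 mean_dist.
Proof.
apply: (le_integrable measurableT _ _ (L1_D (L1_cst P (mean_dist 0)) L1_norm2)).
  apply/measurable_EFinP; apply: continuous_measurable_Rvec => x.
  apply/continuous_atP => e e0.
  have /continuous_atP/(_ e e0) := @continuous_norm2B R p x x.
  apply: (@filterS _ _ (nbhs_filter x)) => y /=; rewrite subrr.
  have -> : norm2 (0 : 'rV[R]_p) = 0.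
    by rewrite norm2_dotv /dotv big1 ?sqrtr0 // => i _; rewrite mxE mul0r.
  rewrite sub0r normrN ger0_norm ?norm2_ge0 // norm2_distC.
  exact/le_lt_trans/mean_dist_lip.
move=> x _; rewrite /= lee_fin.
have h0 y : 0 <= mean_dist y by apply: Rintegral_ge0 => z _; exact: norm2_ge0.
rewrite !ger0_norm ?addr_ge0 ?norm2_ge0 //.
have := mean_dist_lip x 0; rewrite subr0; have := ler_norm (mean_dist x - mean_dist 0).
lra.
Qed.

(** The kernel [- norm2 (x - y)] centred under [P] in both variables; its average over all pairs of
    points is the energy. *)
Definition energy_kernel (x y : 'rV[R]_p) : R :=
  mean_dist x + mean_dist y - E mean_dist - norm2 (x - y).

Lemma energy_kernelC x y : energy_kernel x y = energy_kernel y x.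
Proof. by rewrite /energy_kernel norm2_distC; ring. Qed.

Lemma energy_kernelxx x : energy_kernel x x = 2 * mean_dist x - E mean_dist.
Proof.
rewrite /energy_kernel subrr norm2_dotv /dotv big1; last first.
  by move=> i _; rewrite mxE mul0r.
by rewrite sqrtr0; ring.
Qed.

Lemma L1_energy_kernel x : L1 (energy_kernel x).
Proof.
apply: L1_B (L1_norm2B x); apply: L1_B (L1_cst P _).
exact: L1_D (L1_cst P _) L1_mean_dist.
Qed.

Lemma mean_energy_kernel x : E (energy_kernel x) = 0.
Proof.
rewrite RintegralB //; last exact: L1_norm2B; last first.
  by apply: L1_B (L1_cst P _); exact: L1_D (L1_cst P _) L1_mean_dist.
rewrite RintegralB //; last exact: L1_cst; last first.
  exact: L1_D (L1_cst P _) L1_mean_dist.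
rewrite RintegralD //; [|exact: L1_cst|exact: L1_mean_dist].
rewrite (mean_cst P (mean_dist x)) (mean_cst P (Rintegral P setT mean_dist)).
by rewrite /mean_dist; ring.
Qed.

Lemma energyE (n : nat) (x : 'I_n -> 'rV[R]_p) : (0 < n)%N ->
  n%:R ^+ 2 * energy P x = \sum_i \sum_j energy_kernel (x i) (x j).
Proof.
move=> n0; have nn0 : n%:R != 0 :> R by rewrite pnatr_eq0 -lt0n.
pose S := \sum_(i < n) \sum_(j < n) norm2 (x i - x j).
have sum_cst (k : R) : \sum_(i < n) k = n%:R * k by rewrite sumr_const card_ord mulr_natl.
pose H := \sum_(i < n) mean_dist (x i); pose C := E mean_dist.
have -> : energy P x = 2 / n%:R * H - (n%:R ^+ 2)^-1 * S - C by [].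
have -> : \sum_i \sum_j energy_kernel (x i) (x j) =
   \sum_i (n%:R * mean_dist (x i) + H - n%:R * C - \sum_j norm2 (x i - x j)).
  apply: eq_bigr => i _; rewrite /energy_kernel !sumrB big_split /=.
  by rewrite (sum_cst (mean_dist (x i))) (sum_cst C).
rewrite !sumrB big_split /= -mulr_sumr (sum_cst H) (sum_cst (n%:R * C)).
by rewrite -/H -/S; field.
Qed.

(** Each centring term depends on at most one of the two indices, so summing over the other produces
    the factor [\sum_i c i = 0]. *)
Lemma energy_form_kernel (I : finType) (c : I -> R) (x : I -> 'rV[R]_p) :
  \sum_i c i = 0 ->
  - (\sum_i \sum_j c i * c j * norm2 (x i - x j)) =
  \sum_i \sum_j c i * c j * energy_kernel (x i) (x j).
Proof.
move=> c0.
pose H := \sum_i c i * mean_dist (x i).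
have -> : \sum_i \sum_j c i * c j * energy_kernel (x i) (x j) =
  \sum_i (c i * mean_dist (x i) * (\sum_j c j) + c i * H
    - c i * E mean_dist * (\sum_j c j) - \sum_j c i * c j * norm2 (x i - x j)).
  apply: eq_bigr => i _; rewrite /H !mulr_sumr -big_split -!sumrB /=.
  by apply: eq_bigr => j _; rewrite /energy_kernel; ring.
rewrite c0 sumrB; under [X in _ = X - _]eq_bigr do rewrite !mulr0 add0r subr0.
by rewrite -mulr_suml c0 mul0r sub0r.
Qed.

End EnergyKernel.

(** * Convergence of Gaussian means along support points *)

Section GaussConvergence.
Context {R : realType} {p : nat} (P : probability (Rvec R p) R).
Local Notation L1 f := (P.-integrable setT (EFin \o (f : Rvec R p -> R))).
Local Notation E f := (Rintegral P setT (f : Rvec R p -> R)).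
Context (L1_norm2 : L1 (@norm2 R p)).

Lemma energy_support_points_le (X : set 'rV[R]_p) (A : set (Rvec R p)) (n : nat)
    (xi : 'I_n -> 'rV[R]_p) : measurable A -> A `<=` X -> P A = 1%E ->
  (0 < n)%N -> support_points P X xi -> energy P xi <= n%:R^-1 * E (mean_dist P).
Proof.
move=> mA AX PA n0 [_ ximin].
have nn0 : 0 < n%:R :> R by rewrite ltr0n.
have iK : L1 (fun x => energy_kernel P x x).
  rewrite (funext (energy_kernelxx P)).
  exact: L1_B (L1_Z _ (L1_mean_dist L1_norm2)) (L1_cst P _).
(* No linear term here. The diagonal [2 * mean_dist P x - E (mean_dist P)] has mean
   [E (mean_dist P)]. *)
have [z Az zle] := greedy_sum_le_mean mA PA (L1_cst P 0) (mean_cst P 0)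
  (energy_kernelC P) (L1_energy_kernel L1_norm2) (mean_energy_kernel L1_norm2) iK n.
apply: le_trans (ximin (fun i => z i) _) _; first by move=> i; exact/AX/Az.
rewrite -(ler_pM2l (exprn_gt0 2 nn0)) energyE //.
move: zle; rewrite big1 // add0r => /le_trans; apply.
rewrite (funext (energy_kernelxx P)) RintegralB //; last exact: L1_cst; last first.
  exact: L1_Z (L1_mean_dist L1_norm2).
rewrite RintegralZl //; last exact: L1_mean_dist.
rewrite (mean_cst P (Rintegral P setT (mean_dist P))).
by rewrite le_eqVlt; apply/orP; left; apply/eqP; field; rewrite gt_eqF.
Qed.

(* The greedy lemma yields [z] such that the empirical measure of [z] is both
   close to [P] at the test function and at small energy distance of [x]. *)
Lemma gauss_mean_dist_le (n : nat) (x : 'I_n -> 'rV[R]_p) a (w h : R) :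
  (0 < n)%N -> 0 < w -> 0 < h <= w -> h <= 1 ->
  h * (n%:R^-1 * \sum_(i < n) gauss (w ^- 2) a (x i) - E (gauss (w ^- 2) a)) ^+ 2
  <= 2 * (subc * energy P x + n%:R^-1 * (subc * E (mean_dist P) +
            E (fun y => (gauss (w ^- 2) a y - E (gauss (w ^- 2) a)) ^+ 2))
          + 12 * h ^+ 2 / w).
Proof.
move=> n0 w0 hw h1; have [h0 hlew] := andP hw.
set t := w ^- 2; have t0 : 0 <= t by rewrite invr_ge0 sqr_ge0.
set m := Rintegral P setT (gauss t a).
pose g (y : 'rV[R]_p) := gauss t a y - m.
pose k := energy_kernel P.
have nn0 : 0 < n%:R :> R by rewrite ltr0n.
have gauss1 y : `|gauss t a y| <= 1.
  by rewrite ger0_norm ?gauss_le1 // ltW // gauss_gt0.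
have iG : L1 (gauss t a) by apply: (@L1_bounded _ _ P _ 1) => //; exact: continuous_gauss.
have ig : L1 g by exact: L1_B iG (L1_cst P m).
have g0 : E g = 0.
  by rewrite RintegralB // ?(mean_cst P m) ?subrr //; exact: L1_cst.
have cg : continuous g.
  by move=> y; apply: continuousB; [exact: continuous_gauss|exact: cst_continuous].
have igg : L1 (fun y => g y ^+ 2).
  apply: (@L1_bounded _ _ _ _ ((1 + `|m|) ^+ 2)).
    by move=> y; apply: continuousM; exact: cg.
  move=> y; rewrite normrX ler_pXn2r ?nnegrE ?addr_ge0 //.
  by rewrite (le_trans (ler_normB _ _)) // lerD2r.
have ikk : L1 (fun x => k x x).
  rewrite (funext (energy_kernelxx P)).
  exact: L1_B (L1_Z _ (L1_mean_dist L1_norm2)) (L1_cst P _).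
have mkk : E (fun x => k x x) = E (mean_dist P).
  rewrite (funext (energy_kernelxx P)) RintegralB //; last exact: L1_cst; last first.
    exact: L1_Z (L1_mean_dist L1_norm2).
  rewrite RintegralZl //; last exact: L1_mean_dist.
  by rewrite (mean_cst P (Rintegral P setT (mean_dist P))); ring.
(* Up to the fixed term in [x] alone, the greedy sum for [f] and [K] is [n ^ 2] times the following:
   [subc] times the energy form of the empirical measure of [x] minus that of [z], plus the squared
   error of [z] at the Gaussian. One bound thus controls both. *)
pose K u v := subc * k u v + g u * g v.
pose f v := \sum_(i < n) (-2 * subc) * k (x i) v.
have ikf (i : 'I_n) : L1 (fun v => (-2 * subc) * k (x i) v).
  exact: L1_Z (L1_energy_kernel L1_norm2 (x i)).
have [if_ mf] := Rintegral_bigsum (index_enum 'I_n) measurableT ikf.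
have f0 : E f = 0.
  rewrite mf big1 // => i _; rewrite RintegralZl //; last exact: L1_energy_kernel.
  by rewrite (mean_energy_kernel L1_norm2) mulr0.
have iK u : L1 (K u).
  exact: L1_D (L1_Z _ (L1_energy_kernel L1_norm2 u)) (L1_Z _ ig).
have mK u : E (K u) = 0.
  rewrite RintegralD //; [|exact: L1_Z (L1_energy_kernel L1_norm2 u)|exact: L1_Z].
  rewrite !RintegralZl //; last exact: L1_energy_kernel.
  by rewrite (mean_energy_kernel L1_norm2) g0; ring.
have KC u v : K u v = K v u by rewrite /K /k energy_kernelC (mulrC (g u)).
have iKK : L1 (fun u => K u u) by exact: L1_D (L1_Z _ ikk) igg.
have mKK : E (fun u => K u u) = subc * E (mean_dist P) + E (fun y => g y ^+ 2).
  by rewrite RintegralD // ?RintegralZl // ?mkk //; exact: L1_Z.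
have [z _ zle] := greedy_sum_le_mean measurableT (probability_setT P) if_ f0 KC iK mK iKK n.
move: zle; rewrite mKK.
set V := Rintegral P setT (fun y => g y ^+ 2); set C := Rintegral P setT (mean_dist P) => zle.
(* The difference of the two empirical measures: total mass [0], total variation [2]. *)
pose c (s : 'I_n + 'I_n) : R := if s is inl _ then n%:R^-1 else - n%:R^-1.
pose y (s : 'I_n + 'I_n) : 'rV[R]_p :=
  match s with inl i => x i | inr j => z j end.
have c0 : \sum_s c s = 0.
  by rewrite big_sumType /= !sumr_const card_ord mulNrn subrr.
have cabs : \sum_s `|c s| = 2.
  rewrite big_sumType /= normrN !sumr_const card_ord gtr0_norm ?invr_gt0 //.
  by rewrite -mulr2n -[_ *+ n]mulr_natr mulVf ?gt_eqF.
pose L := n%:R^-1 * \sum_(i < n) gauss t a (x i).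
pose G := n%:R^-1 * \sum_(j < n) gauss t a (z j).
have cgE : \sum_s c s * gauss t a (y s) = L - G.
  by rewrite big_sumType /= -!mulr_sumr mulNr.
pose Sxz := \sum_(j < n) \sum_(i < n) k (x i) (z j).
pose Szz := \sum_(j < n) \sum_(l < n) k (z j) (z l).
have ckE : \sum_s \sum_s' c s * c s' * k (y s) (y s') =
    n%:R ^- 2 * (n%:R ^+ 2 * energy P x - 2 * Sxz + Szz).
  rewrite energyE // big_sumType /=.
  under eq_bigr do rewrite big_sumType /= -!mulr_sumr.
  under [X in _ + X]eq_bigr do rewrite big_sumType /= -!mulr_sumr.
  rewrite !big_split /= -!mulr_sumr.
  have -> : \sum_(i < n) \sum_(j < n) k (x i) (z j) = Sxz by rewrite exchange_big.
  have -> : \sum_(i < n) \sum_(j < n) k (z i) (x j) = Sxz.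
    by apply: eq_bigr => j _; apply: eq_bigr => i _; exact: energy_kernelC.
  by rewrite -/Szz /k; field; rewrite gt_eqF.
have h_form := gauss_form_le_energy y c0 w0 hw.
rewrite (energy_form_kernel P y c0) ckE cabs in h_form.
have h_sec := gauss_sum_sqr_le c y a t0.
rewrite cgE in h_sec.
have Gz : \sum_(j < n) g (z j) = n%:R * (G - m).
  rewrite /g sumrB sumr_const card_ord -[m *+ n]mulr_natl /G; field.
  by rewrite gt_eqF.
have {}zle : - 2 * subc * Sxz + subc * Szz + (n%:R * (G - m)) ^+ 2 <= n%:R * (subc * C + V).
  move: zle; congr (_ <= _).
  rewrite /f -addrA; congr (_ + _).
    by rewrite /Sxz mulr_sumr; apply: eq_bigr => j _; rewrite mulr_sumr.
  rewrite -Gz expr2 big_distrlr /Szz mulr_sumr -big_split /=.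
  by apply: eq_bigr => j _; rewrite mulr_sumr -big_split.
have {}zle : subc * (n%:R ^- 2 * (n%:R ^+ 2 * energy P x - 2 * Sxz + Szz)) + (G - m) ^+ 2
    <= subc * energy P x + n%:R^-1 * (subc * C + V).
  rewrite -(ler_pM2l (exprn_gt0 2 nn0)).
  have -> : n%:R ^+ 2 * (subc * (n%:R ^- 2 * (n%:R ^+ 2 * energy P x - 2 * Sxz + Szz))
      + (G - m) ^+ 2) = subc * n%:R ^+ 2 * energy P x +
      (- 2 * subc * Sxz + subc * Szz + (n%:R * (G - m)) ^+ 2).
    by field; rewrite gt_eqF.
  have -> : n%:R ^+ 2 * (subc * energy P x + n%:R^-1 * (subc * C + V)) =
    subc * n%:R ^+ 2 * energy P x + n%:R * (subc * C + V).
    by field; rewrite gt_eqF.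
  by rewrite lerD2l.
rewrite -/L.
have e12 : h * (2 ^+ 2 * (3 * h / w)) = 12 * h ^+ 2 / w by field; rewrite gt_eqF.
rewrite mulrBr e12 in h_form.
have hLG : h * (L - G) ^+ 2 <= h * \sum_i \sum_j c i * c j * gauss t (y i) (y j).
  by rewrite ler_pM2l.
(* [h <= 1] is used here: the greedy bound controls [(G - m) ^+ 2] without the factor [h]. *)
have hGm : h * (G - m) ^+ 2 <= (G - m) ^+ 2 by rewrite ler_piMl // sqr_ge0.
have hLm : h * (L - m) ^+ 2 <= 2 * (h * (L - G) ^+ 2) + 2 * (h * (G - m) ^+ 2).
  rewrite -subr_ge0.
  have -> : 2 * (h * (L - G) ^+ 2) + 2 * (h * (G - m) ^+ 2) - h * (L - m) ^+ 2 =
    h * (L - G - (G - m)) ^+ 2 by ring.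
  by rewrite mulr_ge0 ?sqr_ge0 // ltW.
move: h_form zle hLG hGm hLm; rewrite -/t -/V -/C.
set M := \sum_i _; lra.
Qed.

Lemma gauss_mean_cvg (X : set 'rV[R]_p) (A : set (Rvec R p))
    (xi : forall n : nat, 'I_n -> 'rV[R]_p) a (t : R) :
  measurable A -> A `<=` X -> P A = 1%E ->
  (forall n : nat, (0 < n)%N -> support_points P X (xi n)) -> 0 < t ->
  (fun n : nat => n%:R^-1 * \sum_(i < n) gauss t a (xi n i)) @ \oo --> E (gauss t a).
Proof.
move=> mA AX PA sp t0.
pose w := (Num.sqrt t)^-1.
have w0 : 0 < w by rewrite invr_gt0 sqrtr_gt0.
have -> : t = w ^- 2 by rewrite /w exprVn invrK sqr_sqrtr // ltW.
set m := Rintegral P setT (gauss (w ^- 2) a).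
pose D := subc * Rintegral P setT (mean_dist P) + (subc * Rintegral P setT (mean_dist P) +
            Rintegral P setT (fun y => (gauss (w ^- 2) a y - m) ^+ 2)).
apply/cvgrPdistC_le => e e0.
(* The term [24 * h ^+ 2 / w] of the bound is at most half of [h * e ^+ 2] once
   [h <= e ^+ 2 * w / 48]; the other half is left for [2 * D / n], with [n] chosen after [h]. *)
pose h := Num.min 1 (Num.min w (e ^+ 2 * w / 48)).
have e20 : 0 < e ^+ 2 * w / 48 by rewrite divr_gt0 ?mulr_gt0 ?exprn_gt0.
have h0 : 0 < h by rewrite !lt_min ltr01 w0 e20.
have h1 : h <= 1 by rewrite ge_min lexx.
have hw : h <= w by rewrite !ge_min lexx orbT.
have he : h <= e ^+ 2 * w / 48 by rewrite !ge_min lexx !orbT.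
near=> n.
have n0 : (0 < n)%N by near: n; exact: nbhs_infty_gt.
have nn0 : 0 < n%:R :> R by rewrite ltr0n.
have := @gauss_mean_dist_le n (xi n) a w h n0 w0 _ h1.
rewrite h0 hw => /(_ isT).
rewrite -/m; set d := _ - m => hd.
have en : subc * energy P (xi n) <= subc * (n%:R^-1 * Rintegral P setT (mean_dist P)).
  apply: ler_wpM2l; last exact: energy_support_points_le mA AX PA n0 (sp n n0).
  by apply: Rintegral_ge0 => u _; rewrite bump_ge0.
suff : d ^+ 2 <= e ^+ 2.
  by rewrite -(real_normK (num_real d)) ler_pXn2r // nnegrE ltW.
rewrite -(ler_pM2l h0); apply: (le_trans hd).
have nD : 4 * D <= n%:R * (h * e ^+ 2).
  rewrite -ler_pdivrMr ?mulr_gt0 ?exprn_gt0 //.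
  by apply/ltW; near: n; exact: nbhs_infty_gtr.
have {}nD : n%:R^-1 * D <= h * e ^+ 2 / 4.
  by rewrite mulrC ler_pdivrMr //; lra.
have h12 : 12 * h ^+ 2 / w <= h * e ^+ 2 / 4.
  rewrite ler_pdivrMr //.
  have : h * h <= h * (e ^+ 2 * w / 48) by rewrite ler_pM2l.
  by rewrite expr2; lra.
move: nD en; rewrite /D mulrDr; set x1 := Rintegral _ _ _; set x2 := subc * energy _ _.
by rewrite -/m; lra.
Unshelve. all: end_near. Qed.

End GaussConvergence.

(** * The uniform closure of the Gaussians *)

Section GaussClosure.
Context {R : realType} {p : nat}.
Implicit Types (f g : 'rV[R]_p -> R) (x y a b : 'rV[R]_p).

(* Constants are included, as [gauss 0 a] is the constant [1]. *)
Inductive gauss_span : ('rV[R]_p -> R) -> Prop :=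
| gauss_span0 : gauss_span (fun=> 0)
| gauss_spanZD c t a f : 0 <= t -> gauss_span f ->
    gauss_span (fun x => c * gauss t a x + f x).

Lemma gauss0 a x : gauss 0 a x = 1.
Proof. by rewrite /gauss mul0r oppr0 expR0. Qed.

(** Completing the square: the new centre is the weighted mean of [a] and [b], which requires
    [t + s] to be nonzero. *)
Lemma gaussM t s a b : 0 <= t -> 0 <= s ->
  exists k c, forall x, gauss t a x * gauss s b x = k * gauss (t + s) c x.
Proof.
move=> t0 s0; have [ts0|ts0] := eqVneq (t + s) 0.
  have -> : t = 0 by lra.
  have -> : s = 0 by lra.
  by exists 1, 0 => x; rewrite addr0 !gauss0 mul1r.
pose c := (t + s)^-1 *: (t *: a + s *: b).
exists (expR (- (t * dotv a a + s * dotv b b - (t + s) * dotv c c))), c => x.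
rewrite /gauss -!expRD; congr expR.
suff : t * dotv (x - a) (x - a) + s * dotv (x - b) (x - b) =
    t * dotv a a + s * dotv b b - (t + s) * dotv c c +
    (t + s) * dotv (x - c) (x - c) by lra.
rewrite /dotv !mulr_sumr -!big_split -sumrB -big_split /=.
by apply: eq_bigr => i _; rewrite !mxE; field.
Qed.

Lemma gauss_spanD f g : gauss_span f -> gauss_span g ->
  gauss_span (fun x => f x + g x).
Proof.
move=> + sg; elim=> [|c t a {}f t0 _ IH].
  by under eq_fun do rewrite add0r.
by under eq_fun do rewrite -addrA; exact: gauss_spanZD.
Qed.

Lemma gauss_spanZ k f : gauss_span f -> gauss_span (fun x => k * f x).
Proof.
elim=> [|c t a {}f t0 _ IH].
  by under eq_fun do rewrite mulr0; exact: gauss_span0.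
by under eq_fun do rewrite mulrDr mulrA; exact: gauss_spanZD.
Qed.

Lemma gauss_spanM f g : gauss_span f -> gauss_span g ->
  gauss_span (fun x => f x * g x).
Proof.
move=> sf sg; elim: sf => [|c t a {}f t0 _ IH].
  by under eq_fun do rewrite mul0r; exact: gauss_span0.
under eq_fun do rewrite mulrDl; apply: gauss_spanD IH.
elim: sg => [|d s b {}g s0 _ IH].
  by under eq_fun do rewrite mulr0; exact: gauss_span0.
under eq_fun do rewrite mulrDr; apply: gauss_spanD IH.
have [k [e eE]] := gaussM a b t0 s0.
rewrite (_ : (fun x => _) = fun x => (c * d * k) * gauss (t + s) e x + 0).
  by apply: gauss_spanZD; [exact: addr_ge0|exact: gauss_span0].
apply/funext => x; rewrite addr0 mulrACA eE; exact: mulrA.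
Qed.

Lemma gauss_span_gauss t a : 0 <= t -> gauss_span (gauss t a).
Proof.
move=> t0; rewrite (_ : gauss t a = fun x => 1 * gauss t a x + 0).
  by apply: gauss_spanZD => //; exact: gauss_span0.
by apply/funext => x; rewrite mul1r addr0.
Qed.

Lemma gauss_span_cst (k : R) : gauss_span (fun=> k).
Proof.
rewrite (_ : (fun=> k) = fun x => k * gauss 0 0 x + 0).
  by apply: gauss_spanZD => //; exact: gauss_span0.
by apply/funext => x; rewrite gauss0 mulr1 addr0.
Qed.

Lemma gauss_span_bounded f : gauss_span f -> exists M, forall x, `|f x| <= M.
Proof.
elim=> [|c t a {}f t0 _ [M fM]]; first by exists 0 => x; rewrite normr0.
exists (`|c| + M) => x; apply: le_trans (ler_normD _ _) _.
rewrite lerD // normrM ler_piMr // ger0_norm ?gauss_le1 //.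
by rewrite ltW // gauss_gt0.
Qed.

Lemma gauss_span_continuous f : gauss_span f -> continuous f.
Proof.
elim=> [|c t a {}f t0 _ cf] x; first exact: cst_continuous.
apply: (@continuousD _ _ _ (fun x => c * gauss t a x)); last exact: cf.
by apply: continuousM; [exact: cst_continuous|exact: continuous_gauss].
Qed.

Definition gauss_closure f : Prop := forall e : R, 0 < e ->
  exists2 g, gauss_span g & forall x, `|f x - g x| <= e.

Lemma gauss_closure_span f : gauss_span f -> gauss_closure f.
Proof. by move=> sf e e0; exists f => // x; rewrite subrr normr0 ltW. Qed.

Lemma gauss_closure_bounded f : gauss_closure f -> exists M, forall x, `|f x| <= M.
Proof.
move=> /(_ 1 ltr01)[g /gauss_span_bounded[M gM] fg].
exists (1 + M) => x; rewrite -(subrK (g x) (f x)).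
by rewrite (le_trans (ler_normD _ _)) // lerD.
Qed.

Lemma gauss_closureD f g : gauss_closure f -> gauss_closure g ->
  gauss_closure (fun x => f x + g x).
Proof.
move=> cf cg e e0; have e2 : 0 < e / 2 by rewrite divr_gt0.
have [f' sf' ff'] := cf _ e2; have [g' sg' gg'] := cg _ e2.
exists (fun x => f' x + g' x) => [|x]; first exact: gauss_spanD.
rewrite opprD addrACA (le_trans (ler_normD _ _)) //.
by have := ff' x; have := gg' x; lra.
Qed.

Lemma gauss_closureM f g : gauss_closure f -> gauss_closure g ->
  gauss_closure (fun x => f x * g x).
Proof.
move=> cf cg e e0.
have [M fM] := gauss_closure_bounded cf.
have M0 : 0 <= M by exact: le_trans (fM 0).
have eM : 0 < e / (2 * (M + 1)) by rewrite divr_gt0 ?mulr_gt0 //; lra.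
have [g' sg' gg'] := cg _ eM.
have [N gN] := gauss_span_bounded sg'.
have N0 : 0 <= N by exact: le_trans (gN 0).
have eN : 0 < e / (2 * (N + 1)) by rewrite divr_gt0 ?mulr_gt0 //; lra.
(* The tolerance for [f] depends on the bound [N] of the approximant [g'], so [g] is approximated
   first. *)
have [f' sf' ff'] := cf _ eN.
exists (fun x => f' x * g' x) => [|x]; first exact: gauss_spanM.
have -> : f x * g x - f' x * g' x = f x * (g x - g' x) + (f x - f' x) * g' x by ring.
rewrite (le_trans (ler_normD _ _)) // !normrM.
have h1 : `|f x| * `|g x - g' x| <= (M + 1) * (e / (2 * (M + 1))).
  by apply: ler_pM => //; have := fM x; lra.
have h2 : `|f x - f' x| * `|g' x| <= (e / (2 * (N + 1))) * (N + 1).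
  by apply: ler_pM => //; have := gN x; lra.
have e1 : (M + 1) * (e / (2 * (M + 1))) = e / 2 by field; rewrite gt_eqF //; lra.
have e2 : (e / (2 * (N + 1))) * (N + 1) = e / 2 by field; rewrite gt_eqF //; lra.
lra.
Qed.

Lemma gauss_closureZ k f : gauss_closure f -> gauss_closure (fun x => k * f x).
Proof. by apply: gauss_closureM; apply/gauss_closure_span/gauss_span_cst. Qed.

Lemma gauss_closure_lim f : (forall e : R, 0 < e ->
  exists2 g, gauss_closure g & forall x, `|f x - g x| <= e) -> gauss_closure f.
Proof.
move=> cf e e0; have e2 : 0 < e / 2 by rewrite divr_gt0.
have [g cg fg] := cf _ e2; have [g' sg' gg'] := cg _ e2.
exists g' => // x; rewrite -(subrKA (g x)) (le_trans (ler_normD _ _)) //.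
by have := fg x; have := gg' x; lra.
Qed.

(** The classical polynomial iteration for the square root of [u ^+ 2], as in proofs of the
    Stone-Weierstrass theorem; being polynomial, it stays inside an algebra. *)
Fixpoint abs_approx (n : nat) (u : R) : R :=
  if n is m.+1 then abs_approx m u + (u ^+ 2 - abs_approx m u ^+ 2) / 2 else 0.

(* The invariant is [(|u| - q_n) (1 + n |u| / 2) <= |u|]. *)
Lemma abs_approx_le n (u : R) : `|u| <= 1 -> (0 < n)%N ->
  `| `|u| - abs_approx n u| <= 2 / n%:R.
Proof.
move=> u1 n0; set v := `|u|.
have v0 : 0 <= v by exact: normr_ge0.
have uv : u ^+ 2 = v ^+ 2 by rewrite /v real_normK ?num_real.
have [q0 [qv inv]] : 0 <= abs_approx n u /\ abs_approx n u <= v /\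
    (v - abs_approx n u) * (1 + n%:R * v / 2) <= v.
  elim: n {n0} => [|n [q0 [qv inv]]] /=; first by rewrite subr0 !mul0r addr0 mulr1.
  rewrite uv; move: q0 qv inv; set q := abs_approx n u => q0 qv inv.
  have nn : 0 <= n%:R :> R by [].
  have step : v - (q + (v ^+ 2 - q ^+ 2) / 2) = (v - q) * (1 - (v + q) / 2) by field.
  have st0 : 0 <= (v - q) * (1 - (v + q) / 2).
    by apply: mulr_ge0; rewrite /v in v0 qv *; lra.
  split; first by have : q ^+ 2 <= v ^+ 2 by [rewrite ler_pXn2r ?nnegrE]; lra.
  split; first by move: st0; rewrite -step; lra.
  rewrite step; apply: le_trans inv; rewrite -mulrA; apply: ler_wpM2l; first lra.
  (* As [q >= 0], the error shrinks by at least the factor [1 - v / 2], and [(1 - v / 2) * (1 + (n +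
     1) * v / 2) <= 1 + n * v / 2]. *)
  apply: (@le_trans _ _ ((1 - v / 2) * (1 + n.+1%:R * v / 2))).
    by apply: ler_wpM2r; [rewrite addr_ge0 // divr_ge0 // mulr_ge0|lra].
  rewrite -[n.+1]addn1 natrD.
  have : 0 <= n%:R * (v * v) by rewrite !mulr_ge0.
  have : 0 <= v * v by rewrite mulr_ge0.
  by lra.
rewrite ger0_norm ?subr_ge0 // ler_pdivlMr ?ltr0n //.
move: v0; rewrite le_eqVlt => /predU1P[v0|v0].
  have -> : abs_approx n u = 0 by lra.
  by rewrite -v0 subrr mul0r.
have q1 : v - abs_approx n u >= 0 by lra.
suff : (v - abs_approx n u) * n%:R * v <= 2 * v by rewrite ler_pM2r.
by nra.
Qed.

Lemma gauss_closure_abs f : gauss_closure f -> gauss_closure (fun x => `|f x|).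
Proof.
move=> cf; have [M fM] := gauss_closure_bounded cf.
have M0 : 0 <= M by exact: le_trans (fM 0).
pose B := M + 1; have B0 : 0 < B by rewrite /B; lra.
pose u x := B^-1 * f x.
have u1 x : `|u x| <= 1.
  rewrite normrM gtr0_norm ?invr_gt0 // mulrC ler_pdivrMr // mul1r.
  by have := fM x; rewrite /B; lra.
have cu : gauss_closure u by exact: gauss_closureZ.
have -> : (fun x => `|f x|) = fun x => B * `|u x|.
  apply/funext => x; rewrite normrM gtr0_norm ?invr_gt0 // mulrA mulfV ?gt_eqF //.
  by rewrite mul1r.
apply: gauss_closureZ; apply: gauss_closure_lim => e e0.
have [n ne] : exists n : nat, 2 / e < n%:R.
  by have [n _ /(_ n (leqnn n))] := nbhs_infty_gtr (2 / e); exists n.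
have n0 : (0 < n)%N by rewrite -(ltr0n R); apply: lt_trans ne; rewrite divr_gt0.
exists (fun x => abs_approx n (u x)) => [|x]; last first.
  rewrite (le_trans (abs_approx_le (u1 x) n0)) // ler_pdivrMr ?ltr0n //.
  by rewrite mulrC -ler_pdivrMr // ltW.
elim: n {ne n0} => [|n IH] /=; first exact/gauss_closure_span/gauss_span0.
have -> : (fun x => abs_approx n (u x) + (u x ^+ 2 - abs_approx n (u x) ^+ 2) / 2) =
  fun x => abs_approx n (u x) + (2^-1 * (u x * u x) +
     (- 2^-1) * (abs_approx n (u x) * abs_approx n (u x))).
  by apply/funext => x; field.
apply: gauss_closureD => //; apply: gauss_closureD; apply: gauss_closureZ;
  exact: gauss_closureM.
Qed.

Lemma gauss_closure_max f g : gauss_closure f -> gauss_closure g ->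
  gauss_closure (fun x => Num.max (f x) (g x)).
Proof.
move=> cf cg; have -> : (fun x => Num.max (f x) (g x)) =
    fun x => 2^-1 * (f x + g x + `|f x + -1 * g x|).
  apply/funext => x; rewrite mulN1r; case: (leP (f x) (g x)) => fg.
    by rewrite ler0_norm ?subr_le0 //; field.
  by rewrite gtr0_norm ?subr_gt0 //; field.
apply: gauss_closureZ; apply: gauss_closureD; first exact: gauss_closureD.
by apply: gauss_closure_abs; apply: gauss_closureD => //; exact: gauss_closureZ.
Qed.

Lemma dense_rat_rV x (d : R) : 0 < d ->
  exists a : 'rV[rat]_p, forall i, `|x ord0 i - map_mx ratr a ord0 i| < d.
Proof.
move=> d0.
have /choice[a aP] : forall i : 'I_p, exists q : rat, `|x ord0 i - ratr q| < d.
  move=> i; have /rat_in_itvoo[q] : x ord0 i - d < x ord0 i + d by lra.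
  by rewrite in_itv /= => /andP[? ?]; exists q; rewrite ltr_norml; lra.
by exists (\row_i a i) => i; rewrite !mxE.
Qed.

(** A peak of height [q.1.2] at the centre [q.1.1]. The integer [q.2] is both depth and sharpness,
    and rational data make the family countable. *)
Definition rat_bump (q : 'rV[rat]_p * rat * nat) x : R :=
  ratr q.1.2 - q.2%:R + q.2%:R * gauss q.2%:R (map_mx ratr q.1.1) x.

Lemma rat_bump_span q : gauss_span (rat_bump q).
Proof.
apply: gauss_spanD (gauss_span_cst _) _; apply: gauss_spanZ.
exact: gauss_span_gauss.
Qed.

Lemma rat_bump_dense f (M : R) x (e : R) : continuous f ->
  (forall y, `|f y| <= M) -> 0 < e ->
  exists2 q, (forall y, rat_bump q y <= f y) & f x - e <= rat_bump q x.
Proof.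
move=> cf fM e0.
have M0 : 0 <= M by exact: le_trans (fM x).
have /nbhs_ballP[r /= r0 rP] : nbhs x [set y | `|f x - f y| < e / 4].
  by have /continuous_atP := cf x; apply; rewrite divr_gt0.
have /rat_in_itvoo[c] : f x - e / 2 < f x - e / 4 by lra.
rewrite in_itv /= => /andP[c1 c2].
(* [4 / r ^+ 2] makes the Gaussian at most [1/2] at distance [r / 2] from its centre; [4 * M] makes
   the resulting drop [k / 2] exceed [2 * M], which puts the bump below [- M]. *)
have [k kP] : exists k : nat, 4 / r ^+ 2 + 4 * M < k%:R.
  by have [k _ /(_ k (leqnn k))] := nbhs_infty_gtr (4 / r ^+ 2 + 4 * M); exists k.
have r20 : 0 < r ^+ 2 by rewrite exprn_gt0.
have r40 : 0 < 4 / r ^+ 2 by rewrite divr_gt0.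
have k0 : 0 < k%:R :> R by lra.
have kr : 1 <= k%:R * (r / 2) ^+ 2.
  have -> : k%:R * (r / 2) ^+ 2 = k%:R * (r ^+ 2 / 4) by field.
  by rewrite -ler_pdivrMr ?divr_gt0 // mul1r invf_div; lra.
(* Moving the centre off [x] by [d] per coordinate costs at most [k ^ 2 * p * d] at [x], which has
   to be at most [e / 4]; the [+ 1] keeps [D] positive when [p = 0]. *)
pose D := 4 * (k%:R ^+ 2 * p%:R + 1) : R.
have D0 : 0 < D by rewrite mulr_gt0 // ltr_wpDl // mulr_ge0 // sqr_ge0.
pose d := Num.min 1 (Num.min (r / 2) (e / D)).
have d0 : 0 < d by rewrite !lt_min ltr01 !divr_gt0.
have d1 : d <= 1 by rewrite ge_min lexx.
have dr : d <= r / 2 by rewrite !ge_min lexx orbT.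
have de : d <= e / D by rewrite !ge_min lexx !orbT.
have [a aP] := dense_rat_rV x d0.
exists (a, c, k) => [y|]; rewrite /rat_bump /=; set b := map_mx ratr a.
  have := gauss_le1 b y (ltW k0).
  have [yr|] := pselect (ball x r y).
    have := rP y yr; rewrite /= ltr_norml => /andP[_ fy].
    by have := k0; nra.
  move=> nb g1.
  (* Balls of ['rV] are coordinatewise, so a point outside has one distant coordinate. *)
  have [i ri] : exists i, r <= `|x ord0 i - y ord0 i|.
    apply: contrapT => nex; apply: nb; split => // i j; rewrite (ord1 i).
    by rewrite /ball /= ltNge; apply/negP => rj; apply: nex; exists j.
  have rb : r / 2 <= `|y ord0 i - b ord0 i|.
    have := aP i; rewrite -/b => ai.
    have := ler_distD (b ord0 i) (x ord0 i) (y ord0 i).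
    by rewrite (distrC (b ord0 i)); lra.
  have ek : gauss k%:R b y <= 2^-1.
    have le : (r / 2) ^+ 2 <= dotv (y - b) (y - b).
      rewrite -sqr_norm2 ler_pXn2r ?nnegrE ?norm2_ge0 ?(divr_ge0 (ltW r0)) //.
      by apply: le_trans rb _; have := coord_le_norm2 (y - b) i; rewrite !mxE.
    have kd : 1 <= k%:R * dotv (y - b) (y - b).
      by apply: le_trans kr _; rewrite ler_pM2l.
    rewrite /gauss expRN lef_pV2 ?posrE ?expR_gt0 //.
    by have := expR_ge1Dx (k%:R * dotv (y - b) (y - b)); lra.
  have := fM x; have := fM y; rewrite !ler_norml => /andP[fy _] /andP[_ fx].
  by nra.
have g1 : 1 - gauss k%:R b x <= k%:R * dotv (x - b) (x - b).
  by rewrite /gauss; have := expR_ge1Dx (- (k%:R * dotv (x - b) (x - b))); lra.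
have dd : dotv (x - b) (x - b) <= p%:R * d.
  rewrite /dotv (_ : p%:R * d = \sum_(i < p) d); last first.
    by rewrite sumr_const card_ord mulr_natl.
  apply: ler_sum => i _; have := aP i; rewrite -/b !mxE ltr_norml => /andP[].
  move: (_ - _) => u; nra.
have kd : k%:R * (1 - gauss k%:R b x) <= e / 4.
  apply: (@le_trans _ _ (k%:R * (k%:R * (p%:R * d)))).
    rewrite ler_pM2l //; apply: le_trans g1 _; by rewrite ler_pM2l.
  have : D * d <= e by rewrite mulrC -ler_pdivlMr.
  by rewrite /D; have := d0; lra.
by have := kd; lra.
Qed.

End GaussClosure.

(** * Weak convergence *)

Section WeakConvergence.
Context {R : realType} {p : nat} (P : probability (Rvec R p) R).
Local Notation L1 f := (P.-integrable setT (EFin \o (f : Rvec R p -> R))).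
Local Notation E f := (Rintegral P setT (f : Rvec R p -> R)).
Implicit Types f g : 'rV[R]_p -> R.

Lemma le_mean f g : L1 f -> L1 g -> (forall x, f x <= g x) -> E f <= E g.
Proof. by move=> if1 ig fg; apply: le_Rintegral => // x _; exact: fg. Qed.

(* [f] is the supremum of a countable family of functions [rat_bump q <= f];
   finite suprema of these increase to [f]. *)
Lemma gauss_closure_below f (M : R) (e : R) : continuous f ->
  (forall x, `|f x| <= M) -> 0 < e ->
  exists g, [/\ continuous g, gauss_closure g, forall x, g x <= f x &
    E f - e <= E g].
Proof.
move=> cf fM e0.
(* Codes that decode to nothing, or to a bump not below [f], get the harmless default [- M <= f]. *)
pose fam (j : nat) (x : 'rV[R]_p) : R :=
  if unpickle j is Some q then
    if pselect (forall y, rat_bump q y <= f y) then rat_bump q x else - M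
  else - M.
have M0 : 0 <= M by exact: le_trans (fM 0).
have fMN x : - M <= f x by have := fM x; rewrite ler_norml => /andP[].
have famf j x : fam j x <= f x.
  rewrite /fam; case: unpickle => [q|//]; case: (pselect (forall y, rat_bump q y <= f y)) => // qf; exact: qf.
have fam_span j : gauss_span (fam j).
  rewrite /fam; case: unpickle => [q|]; last exact: gauss_span_cst.
  by case: (pselect (forall y, rat_bump q y <= f y)) => ? /=; [exact: rat_bump_span|exact: gauss_span_cst].
pose G := fix G (n : nat) : 'rV[R]_p -> R :=
  if n is m.+1 then fun x => Num.max (G m x) (fam m x) else fun=> - M.
have GM n x : - M <= G n x.
  by elim: n => [|n IH] //=; rewrite le_max IH.
have Gf n x : G n x <= f x.
  by elim: n => [|n IH] //=; rewrite ge_max IH famf.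
have Gcont n : continuous (G n).
  elim: n => [|n IH] x /=; first exact: cst_continuous.
  apply: (@continuous_max _ _ (G n)); first exact: IH.
  exact: gauss_span_continuous.
have Gcl n : gauss_closure (G n).
  elim: n => [|n IH] /=; first exact/gauss_closure_span/gauss_span_cst.
  by apply: gauss_closure_max => //; exact: gauss_closure_span.
have fam_le_G j n x : (j < n)%N -> fam j x <= G n x.
  elim: n => [//|n IH]; rewrite ltnS leq_eqVlt => /predU1P[->|jn] /=.
    by rewrite le_max lexx orbT.
  by rewrite le_max IH.
have Gcvg x : G n x @[n --> \oo] --> f x.
  apply/cvgrPdist_le => d d0.
  have [q qf qx] := rat_bump_dense x cf fM d0.
  (* The successor is needed because [G n] contains [fam j] only for [j < n]. *)
  exists (pickle q).+1 => // n /= qn; rewrite ger0_norm ?subr_ge0 //.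
  have := fam_le_G (pickle q) n x qn; rewrite /fam pickleK.
  by case: (pselect (forall y, rat_bump q y <= f y)) => [?|/(_ qf)] //=; lra.
have GMabs n x : `|G n x| <= M.
  by rewrite ler_norml GM (le_trans (Gf n x)) // (le_trans (ler_norm _)).
have iG n : L1 (G n) by exact: L1_bounded (GMabs n).
have if1 : L1 f by exact: L1_bounded fM.
have EG : E (G n) @[n --> \oo] --> E f.
  have : (\int[P]_x (G n x)%:E)%E @[n --> \oo] --> (\int[P]_x (f x)%:E)%E.
    apply: (@dominated_cvg _ _ _ P setT _ _ _ (fun=> M%:E)) => //.
    - by move=> n; apply/measurable_EFinP; exact: continuous_measurable_Rvec.
    - by move=> x _; apply: cvg_EFin; [exact: nearW|exact: Gcvg].
    - exact: (L1_cst P M).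
    - by move=> n x _; rewrite lee_fin.
  have fE : (E f)%:E = (\int[P]_x (f x)%:E)%E by rewrite fineK ?integrable_fin_num.
  by move=> cvI; apply: fine_cvg; rewrite fE.
have [n _ /(_ n (leqnn n)) /= En] := (cvgrPdist_le _ _).1 EG e e0.
exists (G n); split => //.
by have := le_trans (ler_norm _) En; lra.
Qed.

Context (xi : forall n : nat, 'I_n -> 'rV[R]_p).
Let emp n f : R := n%:R^-1 * \sum_(i < n) f (xi i).

Lemma le_emp n f g : (forall x, f x <= g x) -> emp n f <= emp n g.
Proof.
by move=> fg; rewrite ler_wpM2l ?invr_ge0 //; apply: ler_sum => i _; exact: fg.
Qed.

Context (emp_gauss : forall a t, 0 < t ->
  (fun n => emp n (gauss t a)) @ \oo --> E (gauss t a)).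

Lemma gauss_span_cvg f : gauss_span f -> (fun n => emp n f) @ \oo --> E f.
Proof.
elim=> [|c t a {}f t0 sf IH].
  rewrite (mean_cst P 0) (_ : (fun n => _) = fun=> 0); first exact: cvg_cst.
  by apply/funext => n; rewrite /emp big1 ?mulr0.
have [M fM] := gauss_span_bounded sf.
have if1 : L1 f by apply: L1_bounded fM; exact: gauss_span_continuous.
have ig : L1 (gauss t a).
  apply: (@L1_bounded _ _ P _ 1) => [|x]; first exact: continuous_gauss.
  by rewrite ger0_norm ?gauss_le1 // ltW // gauss_gt0.
rewrite RintegralD //; last exact: L1_Z.
rewrite RintegralZl // (_ : (fun n => _) = (fun n => c * emp n (gauss t a) + emp n f)); last first.
  apply/funext => n; rewrite /emp big_split /= -mulr_sumr mulrDr; congr (_ + _).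
  by rewrite mulrCA.
apply: cvgD => //; apply: cvgM; first exact: cvg_cst.
(* At [t = 0] the Gaussian is the constant [1], whose empirical mean is [1] from [n = 1] on. *)
move: t0; rewrite le_eqVlt => /predU1P[t0|]; last exact: emp_gauss.
have -> : gauss t a = fun=> 1 by apply/funext => x; rewrite -t0 gauss0.
rewrite (mean_cst P 1); apply/cvgrPdist_le => e e0.
exists 1%N => // n /= n0; rewrite /emp sumr_const card_ord mulVf ?pnatr_eq0 -?lt0n //.
by rewrite subrr normr0 ltW.
Qed.

Lemma gauss_closure_cvg f : continuous f -> gauss_closure f ->
  (fun n => emp n f) @ \oo --> E f.
Proof.
move=> cf clf; apply/cvgrPdist_le => e e0.
have e3 : 0 < e / 3 by rewrite divr_gt0.
have [g sg fg] := clf _ e3.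
have [M fM] := gauss_closure_bounded clf.
have [N gN] := gauss_span_bounded sg.
have if1 : L1 f by exact: L1_bounded fM.
have ig : L1 g by apply: L1_bounded gN; exact: gauss_span_continuous.
have k1 x : f x <= g x + e / 3 by have := fg x; rewrite ler_norml => /andP[]; lra.
have k2 x : g x <= f x + e / 3 by have := fg x; rewrite ler_norml => /andP[]; lra.
have E1 : E f <= E g + e / 3.
  rewrite -[X in _ + X](mean_cst P) -RintegralD //; last exact: L1_cst.
  by apply: le_mean => //; apply: L1_D => //; exact: L1_cst.
have E2 : E g <= E f + e / 3.
  rewrite -[X in _ + X](mean_cst P) -RintegralD //; last exact: L1_cst.
  by apply: le_mean => //; apply: L1_D => //; exact: L1_cst.
near=> n.
have n0 : (0 < n)%N by near: n; exact: nbhs_infty_gt.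
have empD h (k : R) : emp n (fun x => h x + k) = emp n h + k.
  rewrite /emp big_split /= mulrDr sumr_const card_ord -[k *+ n]mulr_natl.
  by rewrite mulrA mulVf ?mul1r // pnatr_eq0 -lt0n.
have e1 := le_emp n k1; have e2 := le_emp n k2; rewrite !empD in e1 e2.
have : `|E g - emp n g| <= e / 3.
  by near: n; exact: (cvgrPdist_le _ _).1 (gauss_span_cvg sg) _ e3.
by rewrite !ler_norml => /andP[? ?]; lra.
Unshelve. all: end_near. Qed.

(** A minorant [g] of [f] in the closure loses at most [e / 2] in mean, and [emp n g <= emp n f].
    Applied to [f] and to [- f], this gives the limit. *)
Lemma emp_liminf f (M e : R) : continuous f -> (forall x, `|f x| <= M) -> 0 < e ->
  \forall n \near \oo, E f - e <= emp n f.
Proof.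
move=> cf fM e0; have e2 : 0 < e / 2 by rewrite divr_gt0.
have [g [cg clg gf Eg]] := gauss_closure_below cf fM e2.
near=> n; have : `|E g - emp n g| <= e / 2.
  by near: n; exact: (cvgrPdist_le _ _).1 (gauss_closure_cvg cg clg) _ e2.
by rewrite ler_norml => /andP[? ?]; have := le_emp n gf; lra.
Unshelve. all: end_near. Qed.

Lemma emp_cvg f (M : R) : continuous f -> (forall x, `|f x| <= M) ->
  (fun n => emp n f) @ \oo --> E f.
Proof.
move=> cf fM; apply/cvgrPdist_le => e e0.
have cNf : continuous (fun x => - f x) by move=> x; apply: continuousN; exact: cf.
have NfM x : `|- f x| <= M by rewrite normrN.
have if1 : L1 f by exact: L1_bounded fM.
have EN : E (fun x => - f x) = - E f.
  rewrite (_ : (fun x => - f x) = fun x => -1 * f x); last first.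
    by apply/funext => x; rewrite mulN1r.
  by rewrite RintegralZl // mulN1r.
near=> n.
have l1 : E f - e <= emp n f by near: n; exact: emp_liminf cf fM e0.
have : E (fun x => - f x) - e <= emp n (fun x => - f x).
  by near: n; exact: emp_liminf cNf NfM e0.
have -> : emp n (fun x => - f x) = - emp n f by rewrite /emp sumrN mulrN.
by rewrite EN ler_norml => l2; lra.
Unshelve. all: end_near. Qed.

End WeakConvergence.

Theorem theorem2 (R : realType) (p : nat) (P : probability (Rvec R p) R)
  (X : set 'rV[R]_p) :
  X !=set0 ->
  (exists A : set (Rvec R p), [/\ measurable A, A `<=` X & P A = 1%E]) ->
  continuous (dist_fun P) ->
  P.-integrable setT (fun y : Rvec R p => (norm2 y)%:E) ->
  forall xi : forall n : nat, 'I_n -> 'rV[R]_p,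
  (forall n : nat, (0 < n)%N -> support_points P X (xi n)) ->
  forall f : 'rV[R]_p -> R, continuous f -> (exists M : R, forall x, `|f x| <= M) ->
  (fun n : nat => n%:R^-1 * \sum_(i < n) f (xi n i)) @ \oo
    --> Rintegral P setT (f : Rvec R p -> R).
Proof.
move=> _ [A [mA AX PA]] _ inorm xi sp f cf [M fM].
apply: (emp_cvg _ cf fM) => a t t0.
exact: gauss_mean_cvg inorm _ _ _ _ _ mA AX PA sp t0.
Qed.
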